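(* Let $a,b,c$ be real numbers with $c\neq 0$ satisfying (A1) $0<b<1$, $c\ge 0$; (A2) $(2a+b)\left(1-\frac{c^2}{(a+b)^2}\right)<4$; (A3) $(a-c)\sqrt2>b+2$. Then the map $F_{a,b,c}:\mathbb{R}^2\to\mathbb{R}^2$, $F_{a,b,c}(x,y)=(1+y-a|x|-cx,\,bx)$, is a Lozi-like map (with $F_1(x,y)=(1+y+(a-c)x,\,bx)$, $F_2(x,y)=(1+y-(a+c)x,\,bx)$ and the $y$-axis as the divider $\Gamma$).
   Context: ''Smooth'' means of class $C^1$. A cone in $\mathbb{R}^2$ is a set $K=\{\mathbf{u}: |\mathbf{u}\cdot\mathbf{v}|\ge \ell\|\mathbf{u}\|\}$ given by a unit vector $\mathbf{v}$ and $\ell\in(0,1)$; its axis is $\{t\mathbf{v}:t\in\mathbb{R}\}$. Two cones are disjoint if they intersect only in $\mathbf{0}$. A pair of cones $K^u,K^s$ is universal if they are disjoint, the axis of $K^u$ is the $x$-axis and the axis of $K^s$ is the $y$-axis. A cone field on an open set $U\subseteq\mathbb{R}^2$ assigns to each $P\in U$ a cone $K_P$ whose axis $\mathbf{v}(P)$ and coefficient $\ell(P)$ vary continuously with $P$. A smooth curve with all tangent vectors in a cone with axis the $x$-axis (resp. $y$-axis) is a graph $y=f(x)$ (resp. $x=f(y)$); it is infinite in both directions if the domain of $f$ is $\mathbb{R}$. $C^1$ diffeomorphisms $F_1,F_2:\mathbb{R}^2\to\mathbb{R}^2$ are synchronously hyperbolic if they are either both orientation reversing or both orientation preserving, and there exist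 $\lambda>1$ (the stretching factor), a universal pair of cones $K^u,K^s$, and cone fields $(K^u_P)_{P\in\mathbb{R}^2}$, $(K^s_P)_{P\in\mathbb{R}^2}$ such that: (S1) for every $P\in\mathbb{R}^2$ and $i=1,2$: $K^u_P\subset K^u$, $K^s_P\subset K^s$, $(DF_i)_P(K^u_P)\subset K^u_{F_i(P)}$, and $(DF_i^{-1})_P(K^s_P)\subset K^s_{F_i^{-1}(P)}$; (S2) for every $P$ and $i=1,2$: $\|(DF_i)_P(\mathbf{u})\|\ge\lambda\|\mathbf{u}\|$ for $\mathbf{u}\in K^u_P$ and $\|(DF_i^{-1})_P(\mathbf{w})\|\ge\lambda\|\mathbf{w}\|$ for $\mathbf{w}\in K^s_P$; (S3) there is a smooth curve $\Gamma\subset\mathbb{R}^2$, infinite in both directions, such that for every $P\in\Gamma$ we have $F_1(P)=F_2(P)$, the vector tangent to $\Gamma$ at $P$ belongs to $K^s_P$, and the vector tangent to $F_i(\Gamma)$ at $F_i(P)$ belongs to $K^u_{F_i(P)}$. $\Gamma$ is called the divider; it divides the plane into the left half-plane and the right half-plane (each taken with the boundary $\Gamma$). A trapping region for a map is a nonempty set that is mapped with its closure into its interior. Given synchronously hyperbolic $F_1,F_2$ with divider $\Gamma$, let $F(P)=F_1(P)$ for $P$ in the left half-plane and $F(P)=F_2(P)$ for $P$ in the right half-plane. $F$ is called Lozi-like if (L1) $-1<\det DF_i(P)<0$ for every $P\in\mathbb{R}^2$ and $i=1,2$; and (L2) there exists a trapping region $\Delta$ for $F$ which is homeomorphic to an open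 disk and whose closure is homeomorphic to a closed disk. *)

(* Defs.v *)
From HB Require Import structures.
From mathcomp Require Import all_boot all_order all_algebra.
From mathcomp Require Import all_classical all_reals all_analysis.

Set Implicit Arguments.
Unset Strict Implicit.
Unset Printing Implicit Defensive.

Import Order.TTheory GRing.Theory Num.Theory.
Import numFieldNormedType.Exports.

Local Open Scope classical_set_scope.
Local Open Scope ring_scope.

Section Plane.
Context {R : realType}.

Definition point (x y : R) : 'rV[R]_2 := \row_j (if j == 0 then x else y).

Definition xcoord (P : 'rV[R]_2) : R := P 0 0.
Definition ycoord (P : 'rV[R]_2) : R := P 0 1.

Definition x_axis : set 'rV[R]_2 := [set P | ycoord P = 0].
Definition y_axis : set 'rV[R]_2 := [set P | xcoord P = 0].

(* The norm `|_| of 'rV[R]_2 is the sup norm, so the Euclidean one is defined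
   here; both induce the same topology. *)
Definition dot (u v : 'rV[R]_2) : R := (u *m v^T) 0 0.
Definition enorm (u : 'rV[R]_2) : R := Num.sqrt (dot u u).

Definition open_disk : set 'rV[R]_2 := [set u | enorm u < 1].
Definition closed_disk : set 'rV[R]_2 := [set u | enorm u <= 1].

End Plane.

Definition homeomorphic (T U : topologicalType) (A : set T) (B : set U) : Prop :=
  exists (f : T -> U) (g : U -> T),
    [/\ {within A, continuous f}, {within B, continuous g},
        (forall x, A x -> B (f x) /\ g (f x) = x) &
        (forall y, B y -> A (g y) /\ f (g y) = y)].

Section Cones.
Context {R : realType}.

Record cone : Type := Cone {
  cone_dir : 'rV[R]_2;
  cone_coef : R;
  cone_dir_unit : enorm cone_dir = 1;
  cone_coef_itv : 0 < cone_coef < 1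
}.

Definition cone_set (K : cone) : set 'rV[R]_2 :=
  [set u | cone_coef K * enorm u <= `|dot u (cone_dir K)|].

Definition cone_axis (K : cone) : set 'rV[R]_2 :=
  [set t *: cone_dir K | t in [set: R]].

Definition disjoint_cones (K L : cone) : Prop :=
  cone_set K `&` cone_set L = [set 0].

Definition universal_pair (Ku Ks : cone) : Prop :=
  [/\ disjoint_cones Ku Ks, cone_axis Ku = x_axis & cone_axis Ks = y_axis].

Definition cone_field (K : 'rV[R]_2 -> cone) : Prop :=
  continuous (cone_dir \o K) /\ continuous (cone_coef \o K).

End Cones.
Arguments cone R : clear implicits.

Section SynchronouslyHyperbolic.
Context {R : realType}.
Implicit Types (F G : 'rV[R]_2 -> 'rV[R]_2) (Gamma : set 'rV[R]_2).

Definition C1_map F : Prop :=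
  (forall P, differentiable F P) /\ continuous (jacobian F).

Definition C1_diffeo F G : Prop :=
  [/\ C1_map F, C1_map G, cancel F G & cancel G F].

Definition orientation_preserving F : Prop := forall P, 0 < \det ('J F P).
Definition orientation_reversing F : Prop := forall P, \det ('J F P) < 0.

(* In the next two definitions G is the inverse of F. *)
Definition cone_invariant (Ku Ks : cone R) (KuP KsP : 'rV[R]_2 -> cone R) F G
    : Prop :=
  forall P : 'rV[R]_2,
    [/\ cone_set (KuP P) `<=` cone_set Ku,
        cone_set (KsP P) `<=` cone_set Ks,
        'd F P @` cone_set (KuP P) `<=` cone_set (KuP (F P)) &
        'd G P @` cone_set (KsP P) `<=` cone_set (KsP (G P))].

Definition cone_stretching (lambda : R) (KuP KsP : 'rV[R]_2 -> cone R) F G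
    : Prop :=
  forall P : 'rV[R]_2,
    (forall u, cone_set (KuP P) u -> lambda * enorm u <= enorm ('d F P u)) /\
    (forall w, cone_set (KsP P) w -> lambda * enorm w <= enorm ('d G P w)).

(* A smooth curve with tangents in a cone around the y-axis and infinite in
   both directions is the graph x = f(y) of a C^1 function f on the whole line;
   it is parametrized by its ordinate. *)
Definition graph_curve (f : R -> R) : R -> 'rV[R]_2 := fun t => point (f t) t.

Definition infinite_smooth_graph (f : R -> R) Gamma : Prop :=
  [/\ forall t, derivable f t 1, continuous f^`()%classic &
      Gamma = range (graph_curve f)].

(* The tangent vector to F(Gamma) at F(P) is the velocity of the image under F
   of the parametrization of Gamma. *)
Definition divider (KuP KsP : 'rV[R]_2 -> cone R) (F1 F2 : 'rV[R]_2 -> 'rV[R]_2)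
    Gamma : Prop :=
  exists2 f : R -> R, infinite_smooth_graph f Gamma &
    forall t : R, let P := graph_curve f t in
      [/\ F1 P = F2 P,
          cone_set (KsP P) ((graph_curve f)^`()%classic t),
          cone_set (KuP (F1 P)) ((F1 \o graph_curve f)^`()%classic t) &
          cone_set (KuP (F2 P)) ((F2 \o graph_curve f)^`()%classic t)].

Definition synchronously_hyperbolic (F1 F2 : 'rV[R]_2 -> 'rV[R]_2) Gamma
    : Prop :=
  exists G1 G2 : 'rV[R]_2 -> 'rV[R]_2,
  [/\ C1_diffeo F1 G1,
      C1_diffeo F2 G2,
      (orientation_reversing F1 /\ orientation_reversing F2) \/
      (orientation_preserving F1 /\ orientation_preserving F2) &
      exists (lambda : R) (Ku Ks : cone R) (KuP KsP : 'rV[R]_2 -> cone R),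
      [/\ 1 < lambda, universal_pair Ku Ks, cone_field KuP & cone_field KsP] /\
      [/\ cone_invariant Ku Ks KuP KsP F1 G1 /\
          cone_invariant Ku Ks KuP KsP F2 G2,
          cone_stretching lambda KuP KsP F1 G1 /\
          cone_stretching lambda KuP KsP F2 G2 &
          divider KuP KsP F1 F2 Gamma]].

End SynchronouslyHyperbolic.

Section LoziLike.
Context {R : realType}.
Implicit Types (F : 'rV[R]_2 -> 'rV[R]_2) (Gamma Delta : set 'rV[R]_2).

(* Half-planes bounded by a graph Gamma over the y-axis, with boundary. *)
Definition left_half_plane Gamma : set 'rV[R]_2 :=
  [set P | exists2 Q, Gamma Q & ycoord P = ycoord Q /\ xcoord P <= xcoord Q].
Definition right_half_plane Gamma : set 'rV[R]_2 :=
  [set P | exists2 Q, Gamma Q & ycoord P = ycoord Q /\ xcoord Q <= xcoord P].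

Definition trapping_region F Delta : Prop :=
  Delta !=set0 /\ F @` closure Delta `<=` interior Delta.

Definition lozi_like (F1 F2 : 'rV[R]_2 -> 'rV[R]_2) Gamma F : Prop :=
  [/\ synchronously_hyperbolic F1 F2 Gamma,
      (forall P, left_half_plane Gamma P -> F P = F1 P) /\
      (forall P, right_half_plane Gamma P -> F P = F2 P),
      (forall P, -1 < \det ('J F1 P) < 0 /\ -1 < \det ('J F2 P) < 0) &
      exists Delta, [/\ trapping_region F Delta,
        homeomorphic Delta (@open_disk R) &
        homeomorphic (closure Delta) (@closed_disk R)]].

Definition Fabc (a b c : R) (P : 'rV[R]_2) : 'rV[R]_2 :=
  point (1 + ycoord P - a * `|xcoord P| - c * xcoord P) (b * xcoord P).
Definition Fabc1 (a b c : R) (P : 'rV[R]_2) : 'rV[R]_2 :=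
  point (1 + ycoord P + (a - c) * xcoord P) (b * xcoord P).
Definition Fabc2 (a b c : R) (P : 'rV[R]_2) : 'rV[R]_2 :=
  point (1 + ycoord P - (a + c) * xcoord P) (b * xcoord P).

End LoziLike.

(* Main.v *)
Require Import Defs.
From HB Require Import structures.
From mathcomp Require Import all_boot all_order all_algebra.
From mathcomp Require Import all_classical all_reals all_analysis.
From mathcomp Require Import ring lra.
Import Order.TTheory GRing.Theory Num.Theory.
Import numFieldNormedType.Exports.
(* Imported again so that point denotes the point with given coordinates and
   not the base point of a pointed type. *)
Import Defs.
Local Open Scope ring_scope.

(** The two branches are [(x, y) |-> (1 + y + s x, b x)] with [s = a - c] and
    [s = - (a + c)]. The third assumption enters through its consequence
    [b + 1 < a - c]: then [T ^ 2 - (a - c) T + b] has a root [l > 1], and the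
    constant cones [|y| <= (b / l) |x|] and [|x| <= (1 / l) |y|] are invariant
    and stretched by [l] for both branches ([synchronously_hyperbolic_Fabc]).

    The trapping region is a triangle ([trapping_Fabc]). Its sides are close
    and parallel to the unstable line of the fixed point [X] in the right
    half-plane, to the stable line of the fixed point [Y] in the left
    half-plane, and to a line of slope [1] through the point [Z] where the
    unstable line of [X] meets the horizontal axis. The first and the third
    side are respected for all parameters; the second one is respected exactly
    when the image of [Z] lies to the right of the stable line of [Y]. In terms
    of the moduli [mu] and [eta] of the unstable eigenvalues at [X] and [Y],
    this means [mu * eta < mu + eta], and the second assumption is the same
    inequality in disguise: once the denominator is cleared, its two sides
    differ by a positive multiple of [mu + eta - mu * eta]
    ([heteroclinic_condition]).

    The triangle contains the origin, so it is the unit ball of a positively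
    homogeneous function. A radial map carries it onto the Euclidean disk
    ([gauge_homeomorphic]), and its closure is given by the corresponding weak
    inequality ([gauge_ball_closure]). *)

(** * Coordinates and affine maps of the plane *)

Section Coordinates.
Context {R : realType}.
Implicit Types (u v P : 'rV[R]_2) (x y s t : R).

Lemma xcoord_point x y : xcoord (point x y) = x.
Proof. by rewrite /xcoord mxE. Qed.

Lemma ycoord_point x y : ycoord (point x y) = y.
Proof. by rewrite /ycoord mxE. Qed.

Lemma point_coord P : point (xcoord P) (ycoord P) = P.
Proof.
apply/rowP => i; rewrite mxE /xcoord /ycoord.
case: ifPn => [/eqP->//|]; case: i => [[|[|//]]] i //= _.
by congr (P _ _); apply/val_inj.
Qed.

Lemma point_inj P v : xcoord P = xcoord v -> ycoord P = ycoord v -> P = v.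
Proof. by move=> Px Py; rewrite -(point_coord P) -(point_coord v) Px Py. Qed.

Lemma xcoordD u v : xcoord (u + v) = xcoord u + xcoord v.
Proof. by rewrite /xcoord mxE. Qed.
Lemma ycoordD u v : ycoord (u + v) = ycoord u + ycoord v.
Proof. by rewrite /ycoord mxE. Qed.
Lemma xcoordZ t u : xcoord (t *: u) = t * xcoord u.
Proof. by rewrite /xcoord mxE. Qed.
Lemma ycoordZ t u : ycoord (t *: u) = t * ycoord u.
Proof. by rewrite /ycoord mxE. Qed.

Definition coordE :=
  (xcoord_point, ycoord_point, xcoordD, ycoordD, xcoordZ, ycoordZ).

Lemma dotE u v : dot u v = xcoord u * xcoord v + ycoord u * ycoord v.
Proof.
rewrite /dot mxE !big_ord_recl big_ord0 addr0 !mxE /xcoord /ycoord.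
by congr (_ + _ * _); congr (_ _ _); apply/val_inj.
Qed.

Lemma enormE u : enorm u = Num.sqrt (xcoord u ^+ 2 + ycoord u ^+ 2).
Proof. by rewrite /enorm dotE !expr2. Qed.

Lemma sqr_enorm u : enorm u ^+ 2 = xcoord u ^+ 2 + ycoord u ^+ 2.
Proof. by rewrite enormE sqr_sqrtr// addr_ge0// sqr_ge0. Qed.

Lemma enorm_ge0 u : 0 <= enorm u.
Proof. exact: sqrtr_ge0. Qed.

End Coordinates.

Section AffineMaps.
Context {R : realType}.
Implicit Types (u v P w : 'rV[R]_2).

Definition affine_map w v1 v2 P := w + xcoord P *: v1 + ycoord P *: v2.

Lemma is_diff_coord_scale (j : 'I_2) v P :
  is_diff P (fun Q : 'rV[R]_2 => Q 0 j *: v) (fun u => u 0 j *: v).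
Proof.
have lin : linear (fun Q : 'rV[R]_2 => Q 0 j *: v).
  by move=> k u w /=; rewrite !mxE scalerDl scalerA.
pose L : {linear 'rV[R]_2 -> 'rV[R]_2} :=
  HB.pack (fun Q : 'rV[R]_2 => Q 0 j *: v) (GRing.isLinear.Build _ _ _ _ _ lin).
have cL : continuous L.
  move=> Q; apply: (@continuous_comp _ _ _ (fun Q : 'rV[R]_2 => Q 0 j)
    (fun t : R => t *: v)); first exact: coord_continuous.
  exact: scalel_continuous.
split; first exact: (@linear_differentiable _ _ _ L).
exact: (@diff_lin _ _ _ L).
Qed.

Lemma is_diff_affine w v1 v2 P :
  is_diff P (affine_map w v1 v2) (fun u => xcoord u *: v1 + ycoord u *: v2).
Proof.
have dx := is_diff_coord_scale 0 v1 P; have dy := is_diff_coord_scale 1 v2 P.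
have := @is_diffD _ _ _ _ _ _ _ _
  (@is_diffD _ _ _ _ _ _ _ _ (is_diff_cst w P) dx) dy.
rewrite /affine_map => -[df dE]; split => //.
by rewrite dE; apply/funext => u; rewrite !fctE add0r.
Qed.

Lemma jacobian_affine w v1 v2 P :
  jacobian (affine_map w v1 v2) P =
  \matrix_(i, j) (if i == 0 then v1 else v2) 0 j.
Proof.
rewrite /jacobian (@diff_val _ _ _ _ _ _ _ (is_diff_affine w v1 v2 P)).
apply/matrixP => i j; rewrite /lin1_mx !mxE /xcoord /ycoord !mxE !eqxx /=.
by case: i => [[|[|//]]] i //=; rewrite ?mul0r ?mul1r ?add0r ?addr0.
Qed.

Lemma det_jacobian_affine w v1 v2 P :
  \det (jacobian (affine_map w v1 v2) P) =
  xcoord v1 * ycoord v2 - ycoord v1 * xcoord v2.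
Proof.
rewrite jacobian_affine (expand_det_row _ 0) !big_ord_recl big_ord0 addr0.
rewrite /cofactor !det_mx11 !mxE /=.
have i0 : lift ord0 ord0 = 1 :> 'I_2 by exact/val_inj.
have i1 : lift 1 ord0 = 0 :> 'I_2 by exact/val_inj.
by rewrite !i0 i1 expr0 mul1r expr1 mulN1r mulrN.
Qed.

Lemma C1_affine w v1 v2 : C1_map (affine_map w v1 v2).
Proof.
split=> [P|]; first by have [] := is_diff_affine w v1 v2 P.
have -> : jacobian (affine_map w v1 v2) =
    cst (\matrix_(i, j) (if i == 0 then v1 else v2) 0 j).
  by apply/funext => P; exact: jacobian_affine.
exact: cst_continuous.
Qed.

Lemma derive1_affine_line w v (t : R) :
  derive1 (fun t : R => w + t *: v) t = v.
Proof.
have [dl dlE] :=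
  @is_diffD _ _ _ _ _ _ _ _ (is_diff_cst w t) (is_diff_scalel t v).
have dE : 'd (fun t : R => w + t *: v) t = (fun h : R => h *: v) :> (R -> _).
  by apply: etrans dlE _; apply/funext => h; rewrite !fctE add0r.
by rewrite derive1E' ?dE ?scale1r.
Qed.

End AffineMaps.

(** * Cones around the coordinate axes *)

Section Cones.
Context {R : realType}.
Implicit Types (u v e : 'rV[R]_2) (k : R).

Lemma enorm_point10 : enorm (point 1 0 : 'rV[R]_2) = 1.
Proof. by rewrite enormE !coordE expr1n expr0n addr0 sqrtr1. Qed.

Lemma enorm_point01 : enorm (point 0 1 : 'rV[R]_2) = 1.
Proof. by rewrite enormE !coordE expr1n expr0n add0r sqrtr1. Qed.

Lemma slope_coef_itv k : 0 < k -> 0 < (Num.sqrt (1 + k ^+ 2))^-1 < 1.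
Proof.
move=> k0; have k2 : 0 < k ^+ 2 by rewrite exprn_gt0.
have s1 : 1 < Num.sqrt (1 + k ^+ 2) by rewrite -[ltLHS]sqrtr1 ltr_sqrt; lra.
by rewrite invr_gt0 (lt_trans ltr01 s1)/= invf_lt1// (lt_trans ltr01 s1).
Qed.

(** The cone of the vectors whose component orthogonal to [e] is at most [k]
    times the one along [e]; the coefficient is the cosine of the half-angle
    whose tangent is [k]. *)
Definition slope_cone e (e1 : enorm e = 1) k (k0 : 0 < k) : cone R :=
  Cone e1 (slope_coef_itv k k0).

Lemma slope_coneP e (e1 : enorm e = 1) k (k0 : 0 < k) u :
  cone_set (slope_cone e e1 k k0) u <->
  enorm u ^+ 2 <= (1 + k ^+ 2) * dot u e ^+ 2.
Proof.
rewrite /cone_set /= mulrC ler_pdivrMr ?sqrtr_gt0; last first.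
  by rewrite ltr_wpDr ?sqr_ge0.
rewrite -ler_sqr ?nnegrE ?enorm_ge0 ?mulr_ge0 ?sqrtr_ge0//.
rewrite exprMn real_normK ?num_real// mulrC.
by rewrite [X in X * _]sqr_sqrtr ?addr_ge0 ?sqr_ge0.
Qed.

Lemma normr_le_mul k (x y : R) : 0 < k ->
  (`|y| <= k * `|x|) = (y ^+ 2 <= k ^+ 2 * x ^+ 2).
Proof.
move=> k0; rewrite -[LHS]ler_sqr ?nnegrE ?mulr_ge0 ?(ltW k0)//.
by rewrite exprMn !real_normK ?num_real.
Qed.

Definition horizontal_cone k (k0 : 0 < k) := slope_cone _ enorm_point10 k k0.
Definition vertical_cone k (k0 : 0 < k) := slope_cone _ enorm_point01 k k0.

Lemma horizontal_coneP k (k0 : 0 < k) u :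
  cone_set (horizontal_cone k k0) u <-> `|ycoord u| <= k * `|xcoord u|.
Proof.
rewrite slope_coneP sqr_enorm dotE !coordE mulr1 mulr0 addr0 mulrDl mul1r.
by rewrite lerD2l normr_le_mul.
Qed.

Lemma vertical_coneP k (k0 : 0 < k) u :
  cone_set (vertical_cone k k0) u <-> `|xcoord u| <= k * `|ycoord u|.
Proof.
rewrite slope_coneP sqr_enorm dotE !coordE mulr1 mulr0 add0r mulrDl mul1r.
by rewrite addrC lerD2l normr_le_mul.
Qed.

Lemma universal_pair_coordinate_cones k k' (k0 : 0 < k) (k0' : 0 < k') :
  k * k' < 1 -> universal_pair (horizontal_cone k k0) (vertical_cone k' k0').
Proof.
move=> kk; split.
- apply/seteqP.
  split => [u [/horizontal_coneP uh /vertical_coneP uv]|u /= ->]; last first.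
    by split; [apply/horizontal_coneP|apply/vertical_coneP];
      rewrite /xcoord /ycoord !mxE !normr0 mulr0.
  have y0 : `|ycoord u| = 0.
    apply/le_anti; rewrite normr_ge0 andbT.
    have := le_trans uh (ler_wpM2l (ltW k0) uv); rewrite mulrA => h.
    have := normr_ge0 (ycoord u); nra.
  rewrite y0 mulr0 in uv.
  have x0 : `|xcoord u| = 0 by apply/le_anti; rewrite normr_ge0 andbT.
  by apply: point_inj; rewrite [RHS]mxE; apply/normr0_eq0.
- apply/seteqP; split => [u [t _ <-]|u] /=; rewrite /x_axis /=.
    by rewrite !coordE mulr0.
  move=> yu; exists (xcoord u) => //; apply: point_inj; rewrite !coordE ?mulr1//.
  by rewrite mulr0 yu.
- apply/seteqP; split => [u [t _ <-]|u] /=; rewrite /y_axis /=.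
    by rewrite !coordE mulr0.
  move=> xu; exists (ycoord u) => //; apply: point_inj; rewrite !coordE ?mulr1//.
  by rewrite mulr0 xu.
Qed.

End Cones.

(** * The two affine branches and their synchronous hyperbolicity *)

Section Branches.
Context {R : realType}.
Implicit Types (u P : 'rV[R]_2) (s b : R).

Definition branch s b : 'rV[R]_2 -> 'rV[R]_2 :=
  affine_map (point 1 0) (point s b) (point 1 0).

Definition branch_inv s b : 'rV[R]_2 -> 'rV[R]_2 :=
  affine_map (point 0 (-1)) (point 0 1) (point b^-1 (- s / b)).

Lemma Fabc1E (a b c : R) : Fabc1 a b c = branch (a - c) b.
Proof.
by apply/funext => P; apply: point_inj; rewrite /Fabc1 !coordE; ring.
Qed.

Lemma Fabc2E (a b c : R) : Fabc2 a b c = branch (- (a + c)) b.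
Proof.
by apply/funext => P; apply: point_inj; rewrite /Fabc2 !coordE; ring.
Qed.

Lemma det_branch s b P : \det (jacobian (branch s b) P) = - b.
Proof. by rewrite det_jacobian_affine !coordE; ring. Qed.

Lemma branch_diffeo s b : b != 0 -> C1_diffeo (branch s b) (branch_inv s b).
Proof.
move=> b0; split; [exact: C1_affine|exact: C1_affine| |] => P;
  by apply: point_inj; rewrite !coordE; field.
Qed.

Lemma diff_branchE s b P u :
  'd (branch s b) P u = point (s * xcoord u + ycoord u) (b * xcoord u).
Proof.
rewrite (@diff_val _ _ _ _ _ _ _ (is_diff_affine _ _ _ P)).
by apply: point_inj; rewrite !coordE; ring.
Qed.

Lemma diff_branch_invE s b P u : 'd (branch_inv s b) P u =
  point (ycoord u / b) (xcoord u - s * (ycoord u / b)).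
Proof.
rewrite (@diff_val _ _ _ _ _ _ _ (is_diff_affine _ _ _ P)).
by apply: point_inj; rewrite !coordE; ring.
Qed.

Section Hyperbolicity.
Variables (s b l : R).
Hypotheses (b0 : 0 < b) (b1 : b < 1) (l1 : 1 < l) (sl : l + b / l <= `|s|).

Let l0 : 0 < l. Proof. exact: lt_trans l1. Qed.

(** The second component of a vector of the unstable cone is at most [b / l]
    times the first one, so of the factor [`|s|] at least
    [`|s| - b / l >= l] survives. *)
Lemma branch_unstable_expansion x y : `|y| <= b / l * `|x| ->
  l * `|x| <= `|s * x + y|.
Proof.
move=> yx; have := lerB_normD (s * x) y; rewrite normrM => h.
have := ler_wpM2r (normr_ge0 x) sl; lra.
Qed.

Lemma branch_stable_expansion x y : `|x| <= l^-1 * `|y| ->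
  l * `|y / b| <= `|x - s * (y / b)|.
Proof.
move=> xy; have := lerB_dist (s * (y / b)) x; rewrite normrM distrC => h.
have h1 := ler_wpM2r (normr_ge0 (y / b)) sl.
have e : b / l * `|y / b| = l^-1 * `|y|.
  by rewrite normrM normfV (gtr0_norm b0); field; rewrite !gt_eqF.
by rewrite mulrDl e in h1; lra.
Qed.

Lemma branch_cone_invariant (bl0 : 0 < b / l) (il0 : 0 < l^-1) :
  cone_invariant (horizontal_cone (b / l) bl0) (vertical_cone l^-1 il0)
    (fun=> horizontal_cone (b / l) bl0) (fun=> vertical_cone l^-1 il0)
    (branch s b) (branch_inv s b).
Proof.
have lN0 : l != 0 by rewrite gt_eqF.
move=> P; split=> //.
- move=> _ [u /horizontal_coneP ux <-]; apply/horizontal_coneP.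
  rewrite diff_branchE !coordE normrM (gtr0_norm b0).
  have -> : b * `|xcoord u| = b / l * (l * `|xcoord u|) by field.
  by rewrite ler_wpM2l ?(ltW bl0)// branch_unstable_expansion.
- move=> _ [u /vertical_coneP uy <-]; apply/vertical_coneP.
  rewrite diff_branch_invE !coordE -[leLHS](mulKf lN0).
  by rewrite ler_wpM2l ?(ltW il0)// branch_stable_expansion.
Qed.

(** Either component of the image is at least [l] times a component of the
    vector: the expansion lemmas bound one of them, and membership in the cone
    the other. *)
Lemma branch_cone_stretching (bl0 : 0 < b / l) (il0 : 0 < l^-1) :
  cone_stretching l (fun=> horizontal_cone (b / l) bl0)
    (fun=> vertical_cone l^-1 il0) (branch s b) (branch_inv s b).
Proof.
have sqr_le (x y : R) : l * `|x| <= `|y| -> l ^+ 2 * x ^+ 2 <= y ^+ 2.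
  move=> h; rewrite -[x ^+ 2]real_normK ?num_real// -exprMn.
  by rewrite -[leRHS]real_normK ?num_real// ler_sqr ?nnegrE ?mulr_ge0 ?(ltW l0).
have bN0 : b != 0 by rewrite gt_eqF.
have lN0 : l != 0 by rewrite gt_eqF.
move=> P; split=> u.
- move=> /horizontal_coneP ux.
  have ey : l * `|ycoord u| <= `|b * xcoord u|.
    rewrite normrM (gtr0_norm b0).
    have -> : b * `|xcoord u| = l * (b / l * `|xcoord u|) by field.
    by rewrite ler_wpM2l ?(ltW l0).
  have ex := branch_unstable_expansion _ _ ux.
  rewrite -ler_sqr ?nnegrE ?mulr_ge0 ?enorm_ge0 ?(ltW l0)// exprMn !sqr_enorm.
  by rewrite diff_branchE !coordE mulrDr lerD// sqr_le.
- move=> /vertical_coneP uy.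
  have ex : l * `|xcoord u| <= `|ycoord u / b|.
    apply: (@le_trans _ _ `|ycoord u|).
      by rewrite -[leRHS](mulVKf lN0) ler_wpM2l ?(ltW l0).
    rewrite normrM normfV (gtr0_norm b0) ler_peMr//.
    by rewrite invf_ge1 ?ltW.
  have ey := branch_stable_expansion _ _ uy.
  have ey' : l * `|ycoord u| <= `|xcoord u - s * (ycoord u / b)|.
    apply: le_trans ey; rewrite ler_wpM2l ?(ltW l0)//.
    rewrite normrM normfV (gtr0_norm b0) ler_peMr//.
    by rewrite invf_ge1 ?ltW.
  rewrite -ler_sqr ?nnegrE ?mulr_ge0 ?enorm_ge0 ?(ltW l0)// exprMn !sqr_enorm.
  by rewrite diff_branch_invE !coordE mulrDr lerD// sqr_le.
Qed.

End Hyperbolicity.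

(** [l] is the larger root of [T ^ 2 - m T + q], which takes a negative value
    at [1]. *)
Lemma expanding_root q m : -1 <= q -> 1 + q < m ->
  exists2 l : R, 1 < l & l + q / l = m.
Proof.
move=> q1 qm.
have disc : (1 - q) ^+ 2 < m ^+ 2 - 4 * q by nra.
have d0 : 0 <= m ^+ 2 - 4 * q by apply: le_trans (ltW disc); exact: sqr_ge0.
set r := Num.sqrt (m ^+ 2 - 4 * q).
have r2 : r ^+ 2 = m ^+ 2 - 4 * q by rewrite sqr_sqrtr.
have rq : 1 - q < r.
  apply: (le_lt_trans (ler_norm _)).
  by rewrite -ltr_sqr ?nnegrE ?sqrtr_ge0// r2 real_normK ?num_real.
have l1 : 1 < (m + r) / 2 by lra.
exists ((m + r) / 2) => //.
have mr : m + r != 0 by lra.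
have -> : q = (m ^+ 2 - r ^+ 2) / 4 by rewrite r2; field.
by field.
Qed.

(** The cone fields are constant: the same two cones serve for both branches,
    since the derivative of a branch is constant and only the bound
    [`|s| >= a - c] on its first entry matters. *)
Lemma synchronously_hyperbolic_Fabc a b c : 0 < b < 1 -> 0 <= c ->
  b + 1 < a - c -> synchronously_hyperbolic (Fabc1 a b c) (Fabc2 a b c) y_axis.
Proof.
move=> /andP[b0 b1] c0 bac.
have [l l1 lE] : exists2 l : R, 1 < l & l + b / l = a - c.
  by apply: expanding_root; lra.
have l0 : 0 < l by exact: lt_trans l1.
have s1 : l + b / l <= `|a - c| by rewrite lE ler_norm.
have s2 : l + b / l <= `|- (a + c)| by rewrite lE normrN ger0_norm; lra.
have bN0 : b != 0 by rewrite gt_eqF.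
rewrite Fabc1E Fabc2E.
exists (branch_inv (a - c) b), (branch_inv (- (a + c)) b).
split; [exact: branch_diffeo|exact: branch_diffeo| |].
  by left; split=> P; rewrite det_branch; lra.
have bl0 : 0 < b / l by exact: divr_gt0.
have il0 : 0 < l^-1 by rewrite invr_gt0.
exists l, (horizontal_cone (b / l) bl0), (vertical_cone l^-1 il0),
  (fun=> horizontal_cone (b / l) bl0), (fun=> vertical_cone l^-1 il0).
split; split => //.
- apply: universal_pair_coordinate_cones.
  rewrite -mulrA -invfM -expr2 ltr_pdivrMr ?exprn_gt0// mul1r.
  by rewrite (lt_trans b1)// exprn_egt1.
- by split; exact: cst_continuous.
- by split; exact: cst_continuous.
- by split; exact: branch_cone_invariant.
- by split; exact: branch_cone_stretching.
- have gE : graph_curve (cst 0 : R -> R) = (fun t : R => 0 + t *: point 0 1).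
    apply/funext => t; apply: point_inj;
    by rewrite !coordE /xcoord /ycoord !mxE /cst/=; ring.
  exists (cst 0).
    split; first by move=> t; exact: derivable_cst.
      have -> : derive1 (cst 0 : R -> R) = cst 0.
        by apply/funext => t; exact: derive1_cst.
      exact: cst_continuous.
    apply/seteqP; split => [u ux|_ [t _ <-]]; last first.
      by rewrite /y_axis /= xcoord_point.
    by exists (ycoord u) => //; apply: point_inj; rewrite !coordE.
  have tg s : (branch s b \o graph_curve (cst 0 : R -> R)) =
      (fun t : R => point 1 0 + t *: point 1 0).
    by apply/funext => t; apply: point_inj; rewrite !coordE /cst; ring.
  move=> t; split.
  + by apply: point_inj; rewrite !coordE /cst; ring.
  + rewrite gE derive1_affine_line; apply/vertical_coneP.
    by rewrite !coordE normr0 normr1 mulr1 ltW.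
  + rewrite tg derive1_affine_line; apply/horizontal_coneP.
    by rewrite !coordE normr0 normr1 mulr1 ltW.
  + rewrite tg derive1_affine_line; apply/horizontal_coneP.
    by rewrite !coordE normr0 normr1 mulr1 ltW.
Qed.

End Branches.

(** * Balls of gauges *)

Section Gauges.
Context {R : realType}.
Implicit Types (P Q : 'rV[R]_2) (N M : 'rV[R]_2 -> R) (A : set R).
Local Open Scope classical_set_scope.

(** A norm without symmetry and subadditivity: enough for its balls to be
    bounded and star-shaped about the origin, with every ray from there
    crossing the boundary once. *)
Definition gauge N : Prop :=
  [/\ continuous N, (forall t P, 0 <= t -> N (t *: P) = t * N P) &
      exists2 C, 0 < C & forall P, `|P| <= C * N P].

Lemma gauge0 N : gauge N -> N 0 = 0.
Proof. by move=> [_ NZ _]; rewrite -[X in N X](scale0r 0) NZ// mul0r. Qed.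

Lemma gauge_ge0 N P : gauge N -> 0 <= N P.
Proof.
move=> [_ _ [C C0 NC]]; rewrite -(pmulr_rge0 _ C0).
exact: le_trans (NC P).
Qed.

Lemma gauge_neq0 N P : gauge N -> P != 0 -> N P != 0.
Proof.
move=> [_ _ [C C0 NC]]; apply: contraNneq => NP.
by rewrite -normr_le0 (le_trans (NC P))// NP mulr0.
Qed.

(** The radial map that carries the level sets of [N] to those of [M]; at the
    origin, the quotient has the harmless default value [0]. *)
Definition gauge_map N M P := (N P / M P) *: P.

Lemma gauge_mapE N M P : gauge N -> gauge M -> M (gauge_map N M P) = N P.
Proof.
move=> gN gM; have [->|P0] := eqVneq P 0.
  by rewrite /gauge_map scaler0 !gauge0.
have [_ MZ _] := gM.
by rewrite /gauge_map MZ ?divr_ge0 ?gauge_ge0// divfK ?gauge_neq0.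
Qed.

Lemma gauge_mapK N M : gauge N -> gauge M ->
  cancel (gauge_map N M) (gauge_map M N).
Proof.
move=> gN gM P; have [->|P0] := eqVneq P 0.
  by rewrite /gauge_map !scaler0.
rewrite {1}/gauge_map gauge_mapE//; have [_ NZ _] := gN.
rewrite /gauge_map NZ ?divr_ge0 ?gauge_ge0// scalerA.
rewrite (_ : _ * _ = 1) ?scale1r//.
by field; rewrite !gauge_neq0.
Qed.

(** The quotient is continuous away from the origin; at the origin, the image
    is controlled by its [M]-gauge, which is the [N]-gauge of the argument. *)
Lemma gauge_map_continuous N M : gauge N -> gauge M ->
  continuous (gauge_map N M).
Proof.
move=> gN gM P; have [->|P0] := eqVneq P 0.
  have [cN _ _] := gN; have [_ _ [C C0 MC]] := gM.
  apply/(@cvgrPdist_lt _ 'rV[R]_2 'rV[R]_2 (nbhs (0 : 'rV[R]_2))) => e e0.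
  have : \forall Q \near (0 : 'rV[R]_2), `|N 0 - N Q| < e / C.
    move/(@cvgrPdist_lt _ R 'rV[R]_2 (nbhs (0 : 'rV[R]_2))): (cN 0).
    by apply; exact: divr_gt0.
  apply: filterS => Q; rewrite gauge0// sub0r normrN ger0_norm ?gauge_ge0// => NQ.
  rewrite {1}/gauge_map scaler0 sub0r normrN (le_lt_trans (MC _))//.
  by rewrite gauge_mapE// mulrC -ltr_pdivlMr.
have [cN _ _] := gN; have [cM _ _] := gM.
have cNM : (fun Q => N Q / M Q) @ P --> N P / M P.
  apply: (@cvgM R _ (nbhs P)); first exact: cN.
  by apply: (@cvgV R _ (nbhs P)); [exact: gauge_neq0|exact: cM].
exact: (@cvgZ R _ 'rV[R]_2 (nbhs P) _ _ id _ _ cNM).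
Qed.

Lemma gauge_homeomorphic N M A : gauge N -> gauge M ->
  homeomorphic (N @^-1` A) (M @^-1` A).
Proof.
move=> gN gM; exists (gauge_map N M), (gauge_map M N); split.
- by apply: continuous_subspaceT; exact: gauge_map_continuous.
- by apply: continuous_subspaceT; exact: gauge_map_continuous.
- by move=> P NP; rewrite /= gauge_mapE// gauge_mapK.
- by move=> P MP; rewrite /= gauge_mapE// gauge_mapK.
Qed.

Lemma gauge_ball_open N : gauge N -> open [set P | N P < 1].
Proof.
move=> [cN _ _].
apply: (@open_comp _ _ N [set x : R | x < 1]) => [P _|]; first exact: cN.
exact: open_lt.
Qed.

Lemma gauge_ball_closure N : gauge N ->
  closure [set P | N P < 1] = [set P | N P <= 1].
Proof.
move=> gN; have [cN NZ _] := gN; apply/seteqP; split.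
  rewrite [X in _ `<=` X](_ : _ = closure [set P | N P <= 1]).
    by apply: closure_subset => P /= /ltW.
  apply/closure_id; apply: (@closed_comp _ _ N [set x : R | x <= 1]) => [P _|].
    exact: cN.
  exact: closed_le.
move=> P /= NP B PB.
have : \forall t \near (1 : R), B (t *: P).
  by have := @scalel_continuous R 'rV[R]_2 P 1 B; rewrite scale1r; apply.
move=> /nbhs_ballP[e /= e0 eB].
(* A slight contraction of P stays near P and enters the open ball. *)
pose h := Num.min e 1 / 2.
have [h0 he h1] : [/\ 0 < h, h < e & h < 1].
  have m0 : 0 < Num.min e 1 by rewrite lt_min e0 ltr01.
  have me : Num.min e 1 <= e by rewrite ge_min lexx.
  have m1 : Num.min e 1 <= 1 by rewrite ge_min lexx orbT.
  by rewrite /h; split; lra.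
exists ((1 - h) *: P); split; last first.
  by apply: eB; rewrite /ball /= opprB addrC subrK gtr0_norm.
rewrite /= NZ; last lra.
have := gauge_ge0 _ P gN; nra.
Qed.

Lemma enorm_gauge : gauge (@enorm R).
Proof.
split.
- move=> P; have -> : @enorm R = Num.sqrt \o
      (fun Q => xcoord Q * xcoord Q + ycoord Q * ycoord Q).
    by apply/funext => Q; rewrite enormE !expr2.
  apply: (@continuous_comp _ _ _ _ Num.sqrt); last exact: sqrt_continuous.
  apply: (@cvgD R R^o _ (nbhs P)).
    by apply: (@cvgM R _ (nbhs P)); exact: coord_continuous.
  by apply: (@cvgM R _ (nbhs P)); exact: coord_continuous.
- move=> t P t0; rewrite !enormE !coordE !exprMn -mulrDr sqrtrM ?sqr_ge0//.
  by rewrite sqrtr_sqr ger0_norm.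
- exists 1 => // P; rewrite mul1r [leLHS]mx_normrE; apply: bigmax_le => [|[i j] _].
    exact: enorm_ge0.
  rewrite /= enormE -sqrtr_sqr ler_wsqrtr//.
  rewrite (ord1 i) /xcoord /ycoord.
  case: j => [[|[|//]]] j.
    by rewrite (_ : Ordinal j = 0) ?lerDl ?sqr_ge0//; exact/val_inj.
  by rewrite (_ : Ordinal j = 1) ?lerDr ?sqr_ge0//; exact/val_inj.
Qed.

(** All gauges have homeomorphic balls, hence those of [N] are disks, as those
    of the Euclidean norm are. *)
Lemma gauge_ball_trapping N F : gauge N ->
  (forall P, N P <= 1 -> N (F P) < 1) ->
  exists Delta, [/\ trapping_region F Delta,
    homeomorphic Delta (@open_disk R) &
    homeomorphic (closure Delta) (@closed_disk R)].
Proof.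
move=> gN NF; exists [set P | N P < 1]; split.
- split; first by exists 0; rewrite /= gauge0.
  rewrite gauge_ball_closure// => _ [P NP <-].
  have /interior_id -> := gauge_ball_open _ gN; exact: NF.
- exact: (gauge_homeomorphic _ _ [set x | x < 1] gN enorm_gauge).
- rewrite gauge_ball_closure//.
  exact: (gauge_homeomorphic _ _ [set x | x <= 1] gN enorm_gauge).
Qed.

End Gauges.

(** * Triangles *)

Section TriangleGauge.
Context {R : realType}.
Variables (p1 q1 p2 q2 p3 q3 : R).
Hypotheses (d12 : 0 < p1 * q2 - p2 * q1) (d23 : 0 < p2 * q3 - p3 * q2)
  (d31 : 0 < p3 * q1 - p1 * q3).

Definition triangle_gauge (P : 'rV[R]_2) : R :=
  Num.max (Num.max (p1 * xcoord P + q1 * ycoord P)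
    (p2 * xcoord P + q2 * ycoord P)) (p3 * xcoord P + q3 * ycoord P).

(** The hypotheses make the three outer normals turn around the origin, so some
    positive combination of the three functionals vanishes: upper bounds on
    the functionals yield lower bounds, hence bounds on the coordinates. *)
Lemma triangle_bounded : exists2 C : R, 0 < C & forall x y r,
  p1 * x + q1 * y <= r -> p2 * x + q2 * y <= r -> p3 * x + q3 * y <= r ->
  `|x| <= C * r /\ `|y| <= C * r.
Proof.
pose e12 := p1 * q2 - p2 * q1; pose e23 := p2 * q3 - p3 * q2.
pose e31 := p3 * q1 - p1 * q3.
have e12_gt0 : 0 < e12 by []; have e23_gt0 : 0 < e23 by [].
have e31_gt0 : 0 < e31 by [].
pose C1 := 1 + (e31 + e12) / e23; pose C2 := 1 + (e12 + e23) / e31.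
pose C := ((`|q1| + `|p1|) * C2 + (`|q2| + `|p2|) * C1) / e12 + 1.
have C1_ge1 : 1 <= C1 by rewrite lerDl ltW// divr_gt0// addr_gt0.
have C2_ge1 : 1 <= C2 by rewrite lerDl ltW// divr_gt0// addr_gt0.
have C10 : 0 < C1 by exact: lt_le_trans C1_ge1.
have C20 : 0 < C2 by exact: lt_le_trans C2_ge1.
have C0 : 0 < C.
  rewrite ltr_wpDl// divr_ge0 ?(ltW e12_gt0)//.
  by apply: addr_ge0; apply: mulr_ge0;
    solve [exact: ltW|exact: addr_ge0].
exists C => // x y r.
set l1 := p1 * x + q1 * y; set l2 := p2 * x + q2 * y; set l3 := p3 * x + q3 * y.
move=> h1 h2 h3.
have E : e23 * l1 + e31 * l2 + e12 * l3 = 0.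
  by rewrite /l1 /l2 /l3 /e12 /e23 /e31; ring.
have r0 : 0 <= r by nra.
have n1 : `|l1| <= C1 * r.
  rewrite ler_norml; apply/andP; split; last first.
    by rewrite (le_trans h1)// ler_peMl.
  rewrite -(ler_pM2l e23_gt0).
  have -> : e23 * - (C1 * r) = - (e23 + e31 + e12) * r.
    by rewrite /C1; field; rewrite gt_eqF.
  nra.
have n2 : `|l2| <= C2 * r.
  rewrite ler_norml; apply/andP; split; last first.
    by rewrite (le_trans h2)// ler_peMl.
  rewrite -(ler_pM2l e31_gt0).
  have -> : e31 * - (C2 * r) = - (e23 + e31 + e12) * r.
    by rewrite /C2; field; rewrite gt_eqF.
  nra.
have xE : x = (q2 * l1 - q1 * l2) / e12.
  by rewrite /l1 /l2 /e12; field; rewrite gt_eqF.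
have yE : y = (p1 * l2 - p2 * l1) / e12.
  by rewrite /l1 /l2 /e12; field; rewrite gt_eqF.
have comb (w1 w2 : R) :
    `|w1| <= `|q1| + `|p1| -> `|w2| <= `|q2| + `|p2| ->
    `|(w2 * l1 + w1 * l2) / e12| <= C * r.
  move=> hw1 hw2; rewrite normrM normfV (gtr0_norm e12_gt0) /C mulrDl mul1r.
  rewrite ler_wpDr// mulrAC ler_wpM2r ?invr_ge0 ?(ltW e12_gt0)//.
  rewrite (le_trans (ler_normD _ _))// !normrM mulrDl addrC -!mulrA.
  by rewrite lerD// ler_pM.
split.
  rewrite xE -mulNr; apply: comb => //; first by rewrite normrN lerDl.
  by rewrite lerDl.
rewrite yE addrC -mulNr; apply: comb => //; first by rewrite lerDr.
by rewrite normrN lerDr.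
Qed.

Lemma triangle_gaugeP : gauge triangle_gauge.
Proof.
pose l (p q : R) (P : 'rV[R]_2) : R^o := p * xcoord P + q * ycoord P.
have cl p q P : {for P, continuous (l p q)}.
  apply: (@cvgD R R^o _ (nbhs P)).
    by apply: (@cvgM R _ (nbhs P)); [exact: cvg_cst|exact: coord_continuous].
  by apply: (@cvgM R _ (nbhs P)); [exact: cvg_cst|exact: coord_continuous].
split.
- move=> P.
  apply: (@continuous_max R _ (l p1 q1 \max l p2 q2)%O (l p3 q3) P) => //.
  exact: continuous_max.
- move=> t P t0; rewrite /triangle_gauge !coordE.
  by rewrite !maxr_pMr//; congr (Num.max (Num.max _ _) _); ring.
- have [C C0 hC] := triangle_bounded.
  exists C => // P.
  have [] := hC (xcoord P) (ycoord P) (triangle_gauge P).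
  + by rewrite /triangle_gauge !le_max lexx.
  + by rewrite /triangle_gauge !le_max lexx orbT.
  + by rewrite /triangle_gauge !le_max lexx !orbT.
  move=> hx hy; rewrite [leLHS]mx_normrE; apply: bigmax_le => [|[i j] _].
    exact: le_trans hx.
  rewrite /= (ord1 i).
  case: j => [[|[|//]]] j.
    by rewrite (_ : Ordinal j = 0)//; exact/val_inj.
  by rewrite (_ : Ordinal j = 1)//; exact/val_inj.
Qed.

End TriangleGauge.

(** * The trapping triangle *)

Section Trapping.
Context {R : realType}.
Implicit Types (a b c mu eta x y : R).

(** Once [a] and [c] are expressed by [mu] and [eta] and the denominator is
    cleared, the difference of the two sides of the assumption on [a], [b], [c]
    factors, and the factor [mu * eta - (mu + eta)] carries its sign. *)
Lemma heteroclinic_condition a b c mu eta :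
  0 < b < 1 -> 1 < mu -> 1 < eta ->
  mu - b / mu = a + c -> eta - b / eta = a - c ->
  (2 * a + b) * (1 - c ^+ 2 / (a + b) ^+ 2) < 4 -> mu * eta < mu + eta.
Proof.
move=> /andP[b0 b1] mu1 eta1 ac amc A2; rewrite ltNge; apply/negP => smn.
have mu0 : 0 < mu by lra.
have eta0 : 0 < eta by lra.
have bm : 0 < b / mu < 1 by rewrite divr_gt0//= ltr_pdivrMr//; lra.
have bn : 0 < b / eta < 1 by rewrite divr_gt0//= ltr_pdivrMr//; lra.
have a0 : 0 < a by lra.
have ab0 : 0 < a + b by lra.
have {A2} : (2 * a + b) * ((a + b) ^+ 2 - c ^+ 2) < 4 * (a + b) ^+ 2.
  rewrite -ltr_pdivrMr ?exprn_gt0//.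
  apply: le_lt_trans A2; rewrite le_eqVlt; apply/orP; left; apply/eqP.
  by field; rewrite gt_eqF.
rewrite ltNge => /negP; apply; rewrite -subr_ge0.
have aE : a = (mu - b / mu + (eta - b / eta)) / 2 by rewrite ac amc; field.
have cE : c = (mu - b / mu - (eta - b / eta)) / 2 by rewrite ac amc; field.
have -> : (2 * a + b) * ((a + b) ^+ 2 - c ^+ 2) - 4 * (a + b) ^+ 2 =
    (mu * eta - (mu + eta)) * (mu + eta + b) *
    ((1 - b / (mu * eta)) ^+ 2 + b / (mu * eta) * (2 * a + b)).
  by rewrite aE cE; field; rewrite !gt_eqF.
apply: mulr_ge0; first by apply: mulr_ge0; lra.
rewrite addr_ge0 ?sqr_ge0// mulr_ge0//; last lra.
by rewrite ltW// divr_gt0// mulr_gt0.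
Qed.

(** Let [X] and [Y] be the fixed points of the second and of the first branch.
    The numbers [- mu] and [eta] are the unstable eigenvalues there. The
    triangle is bounded by
    - a parallel, pushed outwards by [e], to the unstable line
      [b x + mu y = b z] of [X]; the deviation from that line is multiplied by
      [b / mu < 1] under the second branch, and the first branch gives smaller
      values where it applies;
    - a parallel, pushed by [d] to the right, to the stable line
      [x + y / eta = - w] of [Y]; the distance to that line is multiplied by
      [eta > 1] under the first branch;
    - the line of slope [1] through the point [Z = (z, 0)] of the unstable line
      of [X], pushed by [e] to the right; the values of [x - y] on the image
      of the plane below the first side exceed [z] by at most [e / mu].
    Only the stable side can fail to be respected, under the second branch and
    most severely near [Z]; there [f0], which measures how far the image of [Z]
    is to the right of the stable line of [Y], is positive exactly when
    [mu * eta < mu + eta]. *)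
Lemma trapping_Fabc a b c mu eta :
  0 < b < 1 -> 0 <= c -> b + 1 < a - c ->
  1 < mu -> 1 < eta -> mu - b / mu = a + c -> eta - b / eta = a - c ->
  mu * eta < mu + eta ->
  exists2 N : 'rV[R]_2 -> R,
    gauge N & forall P, N P <= 1 -> N (Fabc a b c P) < 1.
Proof.
move=> /andP[b0 b1] c0 bac mu1 eta1 muE etaE smn.
have mu0 : 0 < mu by lra.
have eta0 : 0 < eta by lra.
pose t := b / mu; pose u := b / eta.
pose z := (1 - t)^-1; pose w := (eta - 1)^-1.
have tm : t * mu = b by rewrite divfK// gt_eqF.
have un : u * eta = b by rewrite divfK// gt_eqF.
have ni0 : 0 < eta^-1 by rewrite invr_gt0.
have t0 : 0 < t by exact: divr_gt0.
have u0 : 0 < u by exact: divr_gt0.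
have t1 : t < 1 by rewrite ltr_pdivrMr//; lra.
have u1 : u < 1 by rewrite ltr_pdivrMr//; lra.
have z0 : 0 < z by rewrite invr_gt0; lra.
have w0 : 0 < w by rewrite invr_gt0; lra.
have zt : z * (1 - t) = 1 by rewrite mulVf//; lra.
have wn : w * (eta - 1) = 1 by rewrite mulVf//; lra.
rewrite -/t in muE; rewrite -/u in etaE.
pose f0 := 1 + w - (mu - t - u) * z.
have f00 : 0 < f0.
  have -> : f0 = (mu * eta - b) * (mu + eta - mu * eta) / (mu * eta) * (w * z).
    rewrite /f0 /w /z /t /u; field; apply/and4P; split; lra.
  have mn0 : 0 < mu * eta by rewrite mulr_gt0.
  have mnb : 0 < mu * eta - b by nra.
  by rewrite mulr_gt0 ?(mulr_gt0 w0 z0)// divr_gt0// mulr_gt0// subr_gt0.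
(* The bound d < w keeps the origin, the centre of the gauge, inside. *)
pose d : R := Num.min w f0 / 2.
have [d0 dw df] : [/\ 0 < d, d < w & 2 * d <= f0].
  have h0 : 0 < Num.min w f0 by rewrite lt_min w0 f00.
  have hw : Num.min w f0 <= w by rewrite ge_min lexx.
  have hf : Num.min w f0 <= f0 by rewrite ge_min lexx orbT.
  by rewrite /d; split; lra.
pose e := f0 / (4 * mu).
have e0 : 0 < e by rewrite divr_gt0 ?mulr_gt0.
have em : 4 * (e * mu) = f0 by rewrite /e; field; rewrite gt_eqF.
pose k1 := b * z + e; pose k2 := w - d; pose k3 := z + e.
have k10 : 0 < k1 by rewrite addr_gt0// mulr_gt0.
have k20 : 0 < k2 by rewrite subr_gt0.
have k30 : 0 < k3 by rewrite addr_gt0.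
pose N := triangle_gauge (b / k1) (mu / k1) (- 1 / k2) (- eta^-1 / k2)
  (1 / k3) (- 1 / k3).
have l2E (x y : R) : - 1 * x + - eta^-1 * y = - (x + y / eta) by ring.
have l3E (x y : R) : 1 * x + - 1 * y = x - y by ring.
have Nlt P : (N P < 1) = [&& b * xcoord P + mu * ycoord P < k1,
     - (xcoord P + ycoord P / eta) < k2 & xcoord P - ycoord P < k3].
  rewrite /N /triangle_gauge !gt_max -andbA.
  have D (p q k : R) : 0 < k ->
      (p / k * xcoord P + q / k * ycoord P < 1) =
      (p * xcoord P + q * ycoord P < k).
    by move=> kp; rewrite mulrAC (mulrAC q) -mulrDl ltr_pdivrMr// mul1r.
  by rewrite !D// l2E l3E.
have Nle P : (N P <= 1) = [&& b * xcoord P + mu * ycoord P <= k1,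
     - (xcoord P + ycoord P / eta) <= k2 & xcoord P - ycoord P <= k3].
  rewrite /N /triangle_gauge !ge_max -andbA.
  have D (p q k : R) : 0 < k ->
      (p / k * xcoord P + q / k * ycoord P <= 1) =
      (p * xcoord P + q * ycoord P <= k).
    by move=> kp; rewrite mulrAC (mulrAC q) -mulrDl ler_pdivrMr// mul1r.
  by rewrite !D// l2E l3E.
exists N.
  apply: triangle_gaugeP.
  - have -> : b / k1 * (- eta^-1 / k2) - -1 / k2 * (mu / k1) =
        (mu - u) / (k1 * k2).
      by rewrite /u; field; rewrite !gt_eqF.
    by rewrite divr_gt0 ?mulr_gt0//; lra.
  - have -> : -1 / k2 * (-1 / k3) - 1 / k3 * (- eta^-1 / k2) =
        (1 + eta^-1) / (k2 * k3).
      by field; rewrite !gt_eqF.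
    by rewrite divr_gt0 ?mulr_gt0//; lra.
  - have -> : 1 / k3 * (mu / k1) - b / k1 * (-1 / k3) = (mu + b) / (k1 * k3).
      by field; rewrite !gt_eqF.
    by rewrite divr_gt0 ?mulr_gt0//; lra.
move=> P; rewrite Nle Nlt /Fabc !coordE.
set x := xcoord P; set y := ycoord P; move=> /and3P[h1 h2 h3].
have {}h2 : - (eta * k2) <= eta * x + y.
  have -> : eta * x + y = - (eta * - (x + y / eta)) by field; rewrite gt_eqF.
  by rewrite lerN2 ler_pM2l.
have bxn : b * x / eta = u * x by rewrite /u; ring.
rewrite bxn {bxn}.
have y1 : y + t * x <= t * z + e / mu.
  rewrite -(ler_pM2l mu0).
  have -> : mu * (y + t * x) = b * x + mu * y by rewrite -tm; ring.
  have -> : mu * (t * z + e / mu) = k1 by rewrite /k1 -tm; field; rewrite gt_eqF.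
  by [].
have em1 : e / mu < e by rewrite ltr_pdivrMr// ltr_pMr.
have a0 : 0 < a by lra.
(* The first coordinate of the image is the smaller of those of the branches. *)
have X1 : 1 + y - a * `|x| - c * x <= 1 + y - (mu - t) * x.
  have := ler_wpM2l (ltW a0) (ler_norm x); rewrite muE mulrDl; lra.
have X3 : 1 + y - a * `|x| - c * x - b * x <= 1 + (y + t * x).
  have [x0|x0] := ler0P x.
    have h : 0 <= a - c - b - t by lra.
    have := mulr_ge0_le0 h x0; lra.
  have h : 0 <= a + c + b + t by lra.
  have := mulr_ge0 h (ltW x0); lra.
apply/and3P; split.
(* The unstable side of X *)
- apply: (@le_lt_trans _ _ (b + t * k1)).
    apply: (@le_trans _ _ (b + t * (b * x + mu * y))); last first.
      by rewrite lerD2l ler_pM2l.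
    have h := ler_wpM2l (ltW b0) X1.
    apply: (le_trans (lerD h (lexx _))); rewrite le_eqVlt; apply/orP; left.
    by apply/eqP; rewrite -tm; ring.
  have -> : b + t * k1 = b * (z * (1 - t)) + t * k1 by rewrite zt mulr1.
  have : t * e < e by rewrite gtr_pMl.
  by rewrite /k1; lra.
(* The stable side of Y *)
- have [x0|x0] := ler0P x.
    have -> : 1 + y - a * (- x) - c * x + u * x = 1 + (eta * x + y).
      by rewrite [eta](_ : _ = u + (a - c)); [ring|rewrite -etaE; ring].
    have : d < eta * d by rewrite ltr_pMl.
    rewrite /k2 in h2 *; lra.
  (* The first and third sides meet at an abscissa of at most z + 2 e. *)
  have xz : x <= z + 2 * e.
    rewrite -(ler_pM2l (addr_gt0 b0 mu0)).
    have h := ler_wpM2l (ltW mu0) h3; rewrite /k3 /k1 in h h1.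
    have : 0 < e * b by rewrite mulr_gt0.
    have : e < e * mu by rewrite ltr_pMr.
    lra.
  have -> : 1 + y - a * x - c * x + u * x = 1 + y - (mu - t - u) * x.
    by rewrite [mu](_ : _ = t + (a + c)); [ring|rewrite -muE; ring].
  have ub : u < b by rewrite -un ltr_pMr.
  have g0 : 0 <= mu - t - u - 1 by lra.
  have := ler_wpM2l g0 xz.
  have : f0 = 1 + w - (mu - t - u) * z by [].
  have : 0 < e * t by rewrite mulr_gt0.
  have : 0 < e * u by rewrite mulr_gt0.
  rewrite /k2 /k3 in h3 *; lra.
(* The side of slope 1 *)
- by rewrite /k3; apply: le_lt_trans X3 _; lra.
Qed.

End Trapping.

Theorem mainTheorem12 (R : realType) (a b c : R) (hc : c != 0)
    (A1 : 0 < b < 1 /\ 0 <= c)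
    (A2 : (2 * a + b) * (1 - c ^+ 2 / (a + b) ^+ 2) < 4)
    (A3 : b + 2 < (a - c) * Num.sqrt 2) :
  lozi_like (Fabc1 a b c) (Fabc2 a b c) y_axis (Fabc a b c).
Proof.
have [b01 c0] := A1; have [b0 b1] := andP b01.
have bac : b + 1 < a - c.
  set r := Num.sqrt (2 : R) in A3.
  have r0 : 0 < r by rewrite sqrtr_gt0.
  have r2 : r ^+ 2 = 2 by rewrite sqr_sqrtr.
  have rb : (b + 1) * r < b + 2.
    rewrite -ltr_sqr ?nnegrE; [|by rewrite mulr_ge0 ?(ltW r0)//; lra|lra].
    by rewrite exprMn r2; nra.
  by rewrite -(ltr_pM2r r0); lra.
have [mu mu1 muE] : exists2 mu : R, 1 < mu & mu + - b / mu = a + c.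
  by apply: expanding_root; lra.
have [eta eta1 etaE] : exists2 eta : R, 1 < eta & eta + - b / eta = a - c.
  by apply: expanding_root; lra.
rewrite mulNr in muE; rewrite mulNr in etaE.
have [N gN NF] : exists2 N : 'rV[R]_2 -> R,
    gauge N & forall P, N P <= 1 -> N (Fabc a b c P) < 1.
  apply: (@trapping_Fabc R a b c mu eta) => //.
  exact: heteroclinic_condition A2.
split.
- exact: synchronously_hyperbolic_Fabc.
- split=> P [Q]; rewrite /y_axis /= => -> [_ x0].
    by rewrite /Fabc /Fabc1 ler0_norm//; congr point; ring.
  by rewrite /Fabc /Fabc2 ger0_norm//; congr point; ring.
- have detP s P : -1 < \det (jacobian (branch s b) P) < 0.
    by rewrite det_branch oppr_lt0 ltrN2 b1.
  by move=> P; split; [rewrite Fabc1E|rewrite Fabc2E]; exact: detP.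
- exact: gauge_ball_trapping gN NF.
Qed.
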